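(* Let $(X,p,E)$ be a lattice-normed vector lattice and let $e\in X_+$ be a $p$-unit. Then, for a net $(x_\alpha)$ in $X$, $x_\alpha\xrightarrow{up}0$ if and only if $p(|x_\alpha|\wedge e)\xrightarrow{o}0$ in $E$.
   Context: All vector lattices are real and Archimedean. A net $(x_\alpha)$ in a vector lattice is order convergent to $x$ ($x_\alpha\xrightarrow{o}x$) if there is a net $(y_\beta)$ (possibly with a different index set) with $y_\beta\downarrow 0$ such that for each $\beta$ there is $\alpha_\beta$ with $|x_\alpha-x|\le y_\beta$ for all $\alpha\ge\alpha_\beta$. A lattice-normed vector lattice (LNVL) is a triple $(X,p,E)$, where $X$ and $E$ are vector lattices and $p:X\to E_+$ satisfies: $p(x)=0\Leftrightarrow x=0$; $p(\lambda x)=|\lambda|p(x)$; $p(x+y)\le p(x)+p(y)$; and $|x|\le|y|\Rightarrow p(x)\le p(y)$. A net $x_\alpha$ in $X$ is unbounded $p$-convergent to $x\in X$ ($x_\alpha\xrightarrow{up}x$) if $p(|x_\alpha-x|\wedge u)\xrightarrow{o}0$ in $E$ for every $u\in X_+$. A vector $e\in X$ is a $p$-unit if for every $x\in X_+$ we have $p(x-x\wedge ne)\xrightarrow{o}0$ as $n\to\infty$. *)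

(* Defs.v *)
From HB Require Import structures.
From Corelib Require Import RelationClasses.
From mathcomp Require Import all_boot all_order all_algebra.
From mathcomp Require Import classical_sets reals.

Set Implicit Arguments.
Unset Strict Implicit.
Unset Printing Implicit Defensive.

Import Order.TTheory GRing.Theory Num.Theory.

Local Open Scope classical_set_scope.
Local Open Scope order_scope.
Local Open Scope ring_scope.

HB.mixin Record isArchimedeanVectorLattice (R : realType) V
    of Num.POrderedZmodule V & GRing.Lmodule R V := {
  vmeet : V -> V -> V;
  vjoin : V -> V -> V;
  vmeetP : forall x y z : V, (x <= vmeet y z) = (x <= y) && (x <= z);
  vjoinP : forall x y z : V, (vjoin x y <= z) = (x <= z) && (y <= z);
  vlerD2r : forall x y z : V, x <= y -> x + z <= y + z;
  vscaler_ge0 : forall (a : R) (x : V), 0 <= a -> 0 <= x -> 0 <= a *: x;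
  varchimedean : forall x y : V, (forall n, x *+ n.+1 <= y) -> x <= 0
}.

#[short(type="vectorLatticeType")]
HB.structure Definition ArchimedeanVectorLattice (R : realType) :=
  { V of Num.POrderedZmodule V & GRing.Lmodule R V
       & isArchimedeanVectorLattice R V }.

(* The lattice operations are mixin fields, and the library lattice structure a
   generic instance, because Hierarchy Builder rejects a new structure that
   inherits from both [Order.Lattice] and [GRing.Zmodule]: it would have to be a
   common ancestor of the existing [Num.RealDomain]. *)
#[non_forgetful_inheritance]
HB.instance Definition _ (R : realType) (V : vectorLatticeType R) :=
  Order.POrder_isMeetSemilattice.Build ring_display
    (ArchimedeanVectorLattice.sort V) (@vmeetP R V).
#[non_forgetful_inheritance]
HB.instance Definition _ (R : realType) (V : vectorLatticeType R) :=
  Order.POrder_isJoinSemilattice.Build ring_display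
    (ArchimedeanVectorLattice.sort V) (@vjoinP R V).

Definition vabs (R : realType) (V : vectorLatticeType R) (x : V) : V :=
  x `|` (- x).

Record directedSet := DirectedSet {
  dsort :> Type;
  dle : dsort -> dsort -> Prop;
  dle_preorder : PreOrder dle;
  dle_directed : forall a b, exists c, dle a c /\ dle b c;
  dinhabited : inhabited dsort
}.

Lemma leqn_preorder : PreOrder (fun m n : nat => (m <= n)%N).
Proof. by split=> [n|m n q mn /(leq_trans mn)] //=; exact: leqnn. Qed.

Lemma leqn_directed (m n : nat) : exists q : nat, (m <= q)%N /\ (n <= q)%N.
Proof. by exists (maxn m n); rewrite leq_maxl leq_maxr. Qed.

Definition nat_directed : directedSet :=
  DirectedSet leqn_preorder leqn_directed (inhabits 0%N).

Section OrderConvergence.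
Variables (R : realType) (E : vectorLatticeType R).

Definition decreases_to (J : directedSet) (y : J -> E) (l : E) : Prop :=
  (forall b b' : J, dle b b' -> y b' <= y b) /\ infimums (range y) l.

Definition order_cvg (I : directedSet) (x : I -> E) (l : E) : Prop :=
  exists (J : directedSet) (y : J -> E), decreases_to y 0 /\
    forall b : J, exists a : I, forall a' : I, dle a a' ->
      vabs (x a' - l) <= y b.

End OrderConvergence.

Section LatticeNorm.
Variables (R : realType) (X E : vectorLatticeType R).

(* [lattice_norm p] says that (X, p, E) is a lattice-normed vector lattice *)
Record lattice_norm (p : X -> E) : Prop := LatticeNorm {
  lnorm_ge0 : forall x, 0 <= p x;
  lnorm_eq0 : forall x, p x = 0 <-> x = 0;
  lnormZ : forall (a : R) x, p (a *: x) = `|a| *: p x;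
  lnormD : forall x y, p (x + y) <= p x + p y;
  lnorm_le : forall x y, vabs x <= vabs y -> p x <= p y
}.

Definition up_cvg (p : X -> E) (I : directedSet) (x : I -> X) (l : X) : Prop :=
  forall u : X, 0 <= u -> order_cvg (fun a => p (vabs (x a - l) `&` u)) 0.

Definition p_unit (p : X -> E) (e : X) : Prop :=
  forall x : X, 0 <= x ->
    @order_cvg R E nat_directed (fun n : nat => p (x - x `&` (e *+ n))) 0.

End LatticeNorm.

(* Main.v *)
Require Import Defs.
From Corelib Require RelationClasses.
From mathcomp Require Import all_boot all_order all_algebra.
From mathcomp Require Import classical_sets reals.
Import Order.TTheory GRing.Theory Num.Theory.
Local Open Scope order_scope.
Local Open Scope ring_scope.

(** For w, u >= 0 and every n,
    w /\ u <= (u - u /\ ne) + n (w /\ e), so p(|x_a| /\ u) is bounded by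
    p(u - u /\ ne) + n p(|x_a| /\ e).  Order convergence to 0 of a nonnegative
    net says exactly that the set of its eventual upper bounds has infimum 0:
    that set is directed downwards, so it is itself a decreasing net.  If
    p(u - u /\ ne) is eventually below y_b, then y_b + n z_c is an eventual
    upper bound for some fixed n depending on b; taking the infimum over c
    first and then over b gives 0. *)

Section VectorLattice.
Local Set Implicit Arguments.
Local Unset Strict Implicit.
Variables (R : realType) (V : vectorLatticeType R).
Implicit Types x y z t w : V.

Lemma vlerD x y z t : x <= y -> z <= t -> x + z <= y + t.
Proof.
move=> xy zt; apply: (le_trans (vlerD2r _ _ z xy)).
by rewrite ![y + _]addrC vlerD2r.
Qed.

Lemma vlerBlDr x y z : (x - y <= z) = (x <= z + y).
Proof.
apply/idP/idP => h; first by rewrite -(subrK y x) vlerD2r.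
by rewrite -(addrK y z) vlerD2r.
Qed.

Lemma vsubr_ge0 x y : (0 <= x - y) = (y <= x).
Proof.
apply/idP/idP => h; first by rewrite -(subrK y x) -{1}(add0r y) vlerD2r.
by rewrite -(subrr y) vlerD2r.
Qed.

Lemma vler_wpZ2l (a : R) x y : 0 <= a -> x <= y -> a *: x <= a *: y.
Proof.
by move=> a0 xy; rewrite -vsubr_ge0 -scalerBr vscaler_ge0 ?vsubr_ge0.
Qed.

Lemma vmulrn_ge0 x n : 0 <= x -> 0 <= x *+ n.
Proof. by move=> x0; rewrite -scaler_nat vscaler_ge0. Qed.

Lemma vmeet_ge0 x y : 0 <= x -> 0 <= y -> 0 <= x `&` y.
Proof. by move=> x0 y0; rewrite lexI x0. Qed.

(** Adding [x <= vabs x] and [- x <= vabs x] gives twice the claim; scaling by 1/2 finishes. *)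
Lemma vabs_ge0 x : 0 <= vabs x.
Proof.
have h : 0 <= vabs x + vabs x.
  by rewrite -(subrr x) vlerD // /vabs ?leUl ?leUr.
suff -> : vabs x = 2^-1 *: (vabs x + vabs x) by rewrite vscaler_ge0 ?invr_ge0.
by rewrite -mulr2n -scaler_nat scalerA mulVf ?scale1r // pnatr_eq0.
Qed.

Lemma ger0_vabs x : 0 <= x -> vabs x = x.
Proof.
move=> x0; apply/join_idPl; apply: (le_trans _ x0).
by rewrite -sub0r vlerBlDr add0r.
Qed.

(** Moving one summand at a time to the left and splitting the meet on the right leaves four bounds
    on the left-hand meet: [w] plus a nonnegative term (three times), and [x + y]. *)
Lemma vmeetD_le w x y : 0 <= w -> 0 <= x -> 0 <= y ->
  w `&` (x + y) <= w `&` x + w `&` y.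
Proof.
move=> w0 x0 y0; rewrite -vlerBlDr lexI !vlerBlDr; apply/andP; split.
  by rewrite -[X in X <= _]addr0 vlerD ?leIl ?vmeet_ge0.
rewrite [leRHS]addrC -vlerBlDr lexI !vlerBlDr [y + x]addrC leIr andbT.
by rewrite -[X in X <= _]addr0 vlerD ?leIl.
Qed.

Lemma vmeet_mulrn_le w x n : 0 <= w -> 0 <= x ->
  w `&` (x *+ n) <= (w `&` x) *+ n.
Proof.
move=> w0 x0; elim: n => [|n IHn]; first by rewrite !mulr0n leIr.
rewrite !mulrSr; apply: le_trans (vmeetD_le w0 _ x0) _.
  exact: vmulrn_ge0.
by rewrite vlerD.
Qed.

(** Write [u] as [(u - u /\ nx) + u /\ nx] and apply subadditivity of the meet with [w]; the second
    part is at most [w /\ nx], hence at most [n (w /\ x)]. *)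
Lemma vmeet_le_mulrn w u x n : 0 <= w -> 0 <= u -> 0 <= x ->
  w `&` u <= (u - u `&` (x *+ n)) + (w `&` x) *+ n.
Proof.
move=> w0 u0 x0; have nx0 := vmulrn_ge0 n x0.
rewrite -{1}(subrK (u `&` (x *+ n)) u).
apply: le_trans (vmeetD_le w0 _ _) _; rewrite ?vsubr_ge0 ?leIl ?vmeet_ge0 //.
rewrite vlerD ?leIr //; apply: le_trans (vmeet_mulrn_le n w0 x0).
by rewrite lexI leIl /=; apply: le_trans (leIr _ _) (leIr _ _).
Qed.

End VectorLattice.

Section EventualBounds.
Local Set Implicit Arguments.
Local Unset Strict Implicit.
Variables (R : realType) (E : vectorLatticeType R).

Definition eventual_ub (I : directedSet) (f : I -> E) (d : E) : Prop :=
  exists a : I, forall a' : I, dle a a' -> f a' <= d.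

Variables (I : directedSet) (f : I -> E).

Lemma eventual_ubI c d :
  eventual_ub f c -> eventual_ub f d -> eventual_ub f (c `&` d).
Proof.
move=> [a ha] [b hb]; have [k [ak bk]] := dle_directed a b.
have tr := @RelationClasses.PreOrder_Transitive _ _ (dle_preorder I).
exists k => k' kk'; rewrite lexI ha ?hb //.
  exact: tr bk kk'.
exact: tr ak kk'.
Qed.

Lemma eventual_ub_ge0 d : (forall a, 0 <= f a) -> eventual_ub f d -> 0 <= d.
Proof.
move=> f0 [a ha]; apply: le_trans (f0 a) (ha _ _).
exact: (@RelationClasses.PreOrder_Reflexive _ _ (dle_preorder I)).
Qed.

(** Trades an unspecified dominating net for a canonical one. Positivity makes 0 a lower bound of
    the eventual bounds, so the second clause says that 0 is their infimum; the first makes them a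
    legitimate, inhabited index set. *)
Lemma order_cvg0P : (forall a, 0 <= f a) ->
  order_cvg f 0 <->
  (exists d, eventual_ub f d) /\
  (forall l, (forall d, eventual_ub f d -> l <= d) -> l <= 0).
Proof.
move=> f0; have fE a : vabs (f a - 0) = f a by rewrite subr0 ger0_vabs.
split=> [[J [y [[_ [_ glb]] ub]]]|[[d0 hd0] glb]].
  have ev b : eventual_ub f (y b).
    by have [a ha] := ub b; exists a => a' /ha; rewrite fE.
  split; first by case: (dinhabited J) => b; exists (y b).
  by move=> l hl; apply: glb => _ [b _ <-]; apply/hl/ev.
(* The bounds index themselves, in reversed order, so the inclusion into [E] is decreasing by
   construction. *)
pose D := {d : E | eventual_ub f d}.
pose leD (c d : D) := sval d <= sval c.
have Dpre : RelationClasses.PreOrder leD.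
  split=> [c|c d k cd dk]; first exact: lexx.
  exact: le_trans dk cd.
have Ddir (c d : D) : exists k, leD c k /\ leD d k.
  exists (exist _ _ (eventual_ubI (svalP c) (svalP d))).
  by rewrite /leD /= leIl leIr.
exists (DirectedSet Dpre Ddir (inhabits (exist _ d0 hd0))), (fun d : D => sval d).
split; first split=> [//|].
  split=> [_ [d _ <-]|l hl]; first exact: eventual_ub_ge0 f0 (svalP d).
  by apply: glb => d hd; apply: hl; exists (exist _ d hd).
by move=> [d [a ha]]; exists a => a' /ha; rewrite fE.
Qed.

End EventualBounds.

Section LatticeNormTheory.
Local Set Implicit Arguments.
Local Unset Strict Implicit.
Variables (R : realType) (X E : vectorLatticeType R) (p : X -> E).
Hypothesis hp : lattice_norm p.

Lemma lnorm_ler x y : 0 <= x -> x <= y -> p x <= p y.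
Proof.
move=> x0 xy; apply: (lnorm_le hp).
by rewrite !ger0_vabs // (le_trans x0 xy).
Qed.

Lemma lnormMn x n : p (x *+ n) = p x *+ n.
Proof. by rewrite -scaler_nat (lnormZ hp) normr_nat scaler_nat. Qed.

End LatticeNormTheory.

Theorem theorem3p9 (R : realType) (X E : vectorLatticeType R) (p : X -> E)
    (hp : lattice_norm p) (e : X) (he0 : 0 <= e) (he : p_unit p e)
    (I : directedSet) (x : I -> X) :
  up_cvg p x 0 <-> order_cvg (fun a => p (vabs (x a) `&` e)) 0.
Proof.
have pos u v : 0 <= u -> 0 <= p (vabs v `&` u) by move=> _; exact: lnorm_ge0 hp _.
split=> [/(_ e he0)|h u u0].
  by under [X in order_cvg X]boolp.eq_fun => a do rewrite subr0.
have [[z0 hz0] glbz] := (order_cvg0P (fun a => pos _ (x a) he0)).1 h.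
have [[y0 hy0] glby] :=
  (order_cvg0P (I := nat_directed) (fun n => lnorm_ge0 hp _)).1 (he u u0).
have ev y : eventual_ub (I := nat_directed) (fun n => p (u - u `&` (e *+ n))) y ->
    exists n, forall z, eventual_ub (fun a => p (vabs (x a) `&` e)) z ->
    eventual_ub (fun a => p (vabs (x a - 0) `&` u)) (y + z *+ n.+1).
  (* The multiple used is [n.+1]: still beyond the threshold [n], and invertible as a scalar. It is
     chosen before [z]. *)
  move=> [n hn]; exists n => z [a ha]; exists a => a' /ha hz.
  rewrite subr0; have w0 := vabs_ge0 (x a').
  apply: le_trans (lnorm_ler hp _
    (vmeet_le_mulrn n.+1 w0 u0 he0)) _; first exact: vmeet_ge0.
  apply: le_trans (lnormD hp _ _) _; apply: vlerD; first exact: hn (leqnSn n).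
  by rewrite (lnormMn hp) -!scaler_nat vler_wpZ2l ?hz.
apply/order_cvg0P => [a|]; first exact: pos.
split.
  by have [n hn] := ev _ hy0; exists (y0 + z0 *+ n.+1); exact: hn.
move=> l hl; apply: glby => y /(ev _)[n hn].
(* With [y] and [n] fixed, [l - y <= (n+1) z] for every eventual bound [z]. Dividing by [n+1] makes
   [(l - y)/(n+1)] a lower bound of all such [z], hence at most 0. *)
rewrite -[y]add0r -vlerBlDr.
have n0 : n.+1%:R != 0 :> R by rewrite pnatr_eq0.
rewrite -[l - y](scalerKV n0) -(scaler0 _ (n.+1%:R : R)) vler_wpZ2l //.
apply: glbz => z /hn/hl; rewrite addrC -vlerBlDr -scaler_nat => hz.
by rewrite -[z](scalerK n0) vler_wpZ2l ?invr_ge0.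
Qed.
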